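(* Let $P=\{P_n(x)\}_{n=0}^{\infty}$ be an orthogonal polynomial sequence on the real line in which each $P_n$, $n\ge0$, satisfies a second-order differential equation $$f(x)P_n''(x)+g(x)P_n'(x)+h_nP_n(x)=0,$$ where $f\not\equiv 0$ and $g$ are polynomials independent of $n$ of degrees at most $2$ and $1$ respectively, and $h_n$ is a constant that may depend on $n$. Let $M(x)=\frac{ax+b}{cx+d}$ with $a,b,c,d\in\mathbb{C}$, $ad-bc\ne0$, and set $R_n(x)=P_n(M(x))$ and $Q_n(x)=(cx+d)^nP_n(M(x))$. Then: (i) there are polynomials $F\not\equiv0$ and $G$, independent of $n$, of degrees at most $4$ and $3$ respectively, and constants $H_n$ (which may depend on $n$), such that for all $n\ge0$ $$F(x)R_n''(x)+G(x)R_n'(x)+H_nR_n(x)=0;$$ (ii) there are a polynomial $\mathcal{F}\not\equiv0$ of degree at most $4$, independent of $n$, and polynomials $\mathcal{G}_n$ and $\mathcal{H}_n$ of degrees at most $3$ and $2$ respectively (in general depending on $n$), such that for all $n\ge0$ $$\mathcal{F}(x)Q_n''(x)+\mathcal{G}_n(x)Q_n'(x)+\mathcal{H}_n(x)Q_n(x)=0.$$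
   Context: An orthogonal polynomial sequence on the real line is a sequence of real polynomials $P_n$ with $\deg P_n=n$ such that $\int_l^rP_mP_nw\,dx=K_m\delta_{m,n}$, $K_m>0$, for some interval $(l,r)\subseteq\mathbb{R}$ and some continuous non-negative weight function $w$. The conditions $f\not\equiv0$, $F\not\equiv0$, $\mathcal{F}\not\equiv0$ express that the equations are genuinely of second order. *)

(* Defs.v *)
From mathcomp Require Import all_boot all_order all_algebra.
From mathcomp Require Import complex.
From mathcomp Require Import all_classical all_reals all_analysis.

Set Implicit Arguments.
Unset Strict Implicit.
Unset Printing Implicit Defensive.

Import Order.TTheory GRing.Theory Num.Theory.
Import numFieldNormedType.Exports.

Local Open Scope classical_set_scope.
Local Open Scope ring_scope.

(* R[i], typed so that the topological and normed structures that every
   numFieldType carries (hence derivable and derive1, which here mean complex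
   differentiation) are found by unification. *)
Definition Cplx (R : realType) : numClosedFieldType := R[i]%C.

(* The end points l, r may be infinite, and w matters only on ]l, r[. Since
   w >= 0 there, Lebesgue integrability of all these products is the same as
   convergence of the improper integrals. *)
Definition orthogonal_poly_seq (R : realType) (P : nat -> {poly R}) : Prop :=
  (forall n, size (P n) = n.+1) /\
  exists (l r : \bar R) (w : R -> R) (K : nat -> R),
    let I := [set x : R | (l < x%:E)%E && (x%:E < r)%E] in
    let integrand m n (x : R) := ((P m).[x] * (P n).[x] * w x)%:E in
    [/\ (l < r)%E,
        (forall x, I x -> 0 <= w x) /\ {within I, continuous w},
        forall n, 0 < K n &
        forall m n,
          lebesgue_measure.-integrable I (integrand m n) /\
          (\int[lebesgue_measure]_(x in I) integrand m n x =
            (K m * (m == n)%:R)%:E)%E].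

Definition complex_poly (R : realType) (p : {poly R}) : {poly Cplx R} :=
  map_poly (real_complex R) p.

Definition moebius (C : fieldType) (a b c d x : C) : C :=
  (a * x + b) / (c * x + d).

(* derive1 is a limit that takes a junk value when it does not exist, so
   differentiability is part of being a solution. *)
Definition solves_ode2 (C : numFieldType) (D : set C) (F G H : {poly C})
    (y : C -> C) : Prop :=
  forall x, D x ->
    [/\ derivable y x 1, derivable (derive1 y) x 1 &
        F.[x] * derive1 (derive1 y) x + G.[x] * derive1 y x + H.[x] * y x = 0].

(* Main.v *)
(* Put s = c x + d, D = a d - b c, f~ = s^2 f(M) and g~ = s g(M). Since
   M' = D / s^2, the function r = p o M satisfies p'(M) = s^2 r' / D and
   p''(M) = (s^4 r'' + 2 c s^3 r') / D^2, so f p'' + g p' + h p = 0 becomes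
     s^2 f~ r'' + (2 c s f~ + D s g~) r' + D^2 h r = 0.
   Substituting r = s^-k q and clearing denominators again gives polynomial
   coefficients, because the terms in s^-1 and s^-2 meet factors s and s^2.
   The leading coefficient s^2 f~ is nonzero as M is invertible. *)
Require Import Defs.
From mathcomp Require Import all_boot all_order all_algebra.
From mathcomp Require Import complex.
From mathcomp Require Import all_classical all_reals all_analysis.
From mathcomp Require Import ring.

Set Implicit Arguments.
Unset Strict Implicit.
Unset Printing Implicit Defensive.

Import Order.TTheory GRing.Theory Num.Theory.
Import numFieldNormedType.Exports.

Local Open Scope classical_set_scope.
Local Open Scope ring_scope.

(** * Linear polynomials and degree bounds *)

Section Polynomials.
Variable C : idomainType.
Implicit Types (p q : {poly C}) (k l : C).

Lemma size_linear k l : (size (k *: 'X + l%:P)%R <= 2)%N.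
Proof.
rewrite (leq_trans (size_polyD _ _)) // geq_max.
rewrite (leq_trans (size_scale_leq _ _)) ?size_polyX //.
by rewrite (leq_trans (size_polyC_leq1 _)).
Qed.

Lemma linear_poly_eq0 k l : k *: 'X + l%:P = 0 -> k = 0 /\ l = 0.
Proof.
move=> q0; split.
  have := congr1 (fun q : {poly C} => q`_1) q0.
  by rewrite /= !coefE /= mulr1 addr0.
have := congr1 (fun q : {poly C} => q`_0) q0.
by rewrite /= !coefE /= mulr0 add0r.
Qed.

(** Since [size] is the degree plus one, bounds of the form [m.+1] make the degree bounds add. *)
Lemma leq_size_polyM p q m n :
  (size p <= m.+1)%N -> (size q <= n.+1)%N -> (size (p * q)%R <= (m + n).+1)%N.
Proof.
move=> hp hq; apply: leq_trans (size_polyMleq _ _) _.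
by have := leq_add hp hq; rewrite addSn addnS -subn1 leq_subLR.
Qed.

Lemma leq_size_polyD p q m :
  (size p <= m)%N -> (size q <= m)%N -> (size (p + q)%R <= m)%N.
Proof.
by move=> hp hq; rewrite (leq_trans (size_polyD _ _)) // geq_max hp.
Qed.

Lemma leq_size_polyZ k p m : (size p <= m)%N -> (size (k *: p) <= m)%N.
Proof. exact: leq_trans (size_scale_leq _ _). Qed.

End Polynomials.

(** * Clearing denominators after a Moebius substitution *)

Section Homogenization.
Variables (C : numFieldType) (a b c d : C).
Hypothesis hdet : a * d - b * c != 0.

Let u : {poly C} := a *: 'X + b%:P.
Let s : {poly C} := c *: 'X + d%:P.

(** For p of degree at most m, this is s^m p(u/s) written without division, hence a polynomial that
    also makes sense at the zeros of s. *)
Definition moebius_homog (m : nat) (p : {poly C}) : {poly C} :=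
  \sum_(i < m.+1) p`_i *: (u ^+ i * s ^+ (m - i)).

Lemma size_moebius_homog m p : (size (moebius_homog m p) <= m.+1)%N.
Proof.
apply: (leq_trans (size_sum _ _ _)); apply/bigmax_leqP => i _.
apply: (leq_trans (size_scale_leq _ _)).
have le_size (q : {poly C}) j : (size q <= 2)%N -> (size (q ^+ j) <= j.+1)%N.
  move=> hq; apply: (leq_trans (size_poly_exp_leq _ _)).
  by rewrite ltnS -[leqRHS]mul1n leq_mul2r -subn1 leq_subLR hq orbT.
have im : (i <= m)%N by rewrite -ltnS.
rewrite -[X in (_ <= X.+1)%N](subnKC im).
by apply: leq_size_polyM; apply: le_size; exact: size_linear.
Qed.

(** Termwise s^m (u/s)^i = u^i s^(m-i); the bound on [size p] ensures that the sum up to m misses no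
    coefficient. *)
Lemma horner_moebius_homog m (p : {poly C}) x :
  (size p <= m.+1)%N -> c * x + d != 0 ->
  (moebius_homog m p).[x] = (c * x + d) ^+ m * p.[moebius a b c d x].
Proof.
move=> hp hx; rewrite (horner_coef_wide _ hp) horner_sum mulr_sumr.
apply: eq_bigr => i _; rewrite !hornerE /moebius expr_div_n.
have -> : (c * x + d) ^+ m = (c * x + d) ^+ i * (c * x + d) ^+ (m - i).
  by rewrite -exprD subnKC // -ltnS.
have := expf_neq0 i hx.
by rewrite /=; move: (_ ^+ i) (_ ^+ i) (_ ^+ (m - i)) => v w z hv; field.
Qed.

(** In characteristic 0 the numbers 0, ..., [size p] - 1 are distinct, which is one root too many
    for a nonzero p. *)
Lemma poly_eq0_horner (p : {poly C}) : (forall x, p.[x] = 0) -> p = 0.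
Proof.
move=> p0; apply/eqP/negPn/negP => pn0.
have := max_poly_roots (rs := [seq i%:R | i <- iota 0 (size p)]) pn0.
rewrite map_inj_uniq ?iota_uniq; last exact: mulrIn (oner_neq0 _).
rewrite size_map size_iota ltnn => /(_ _ isT) => H.
suff: false by [].
apply: H; apply/allP => y _; exact/rootP/p0.
Qed.

(** If the homogenization vanishes, so does p at every value of M. A value t can be missed only if a
    - c t = 0, so p(t) (a - c t) vanishes for all t, and the linear factor is not the zero
    polynomial. *)
Lemma moebius_homog_neq0 m (p : {poly C}) : (size p <= m.+1)%N -> p != 0 ->
  moebius_homog m p != 0.
Proof.
move=> hp; apply: contra_neq => hom0.
have q_neq0 : - c *: 'X + a%:P != 0.
  apply: contra_neq hdet => /linear_poly_eq0 [/eqP].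
  by rewrite oppr_eq0 => /eqP -> ->; rewrite mul0r mulr0 subrr.
suff /eqP : p * (- c *: 'X + a%:P) = 0.
  by rewrite mulf_eq0 (negPf q_neq0) orbF => /eqP.
apply: poly_eq0_horner => t; rewrite !hornerE mulNr addrC.
have [->|ht] := eqVneq (a - c * t) 0; first by rewrite mulr0.
(* The preimage of t under M. *)
pose x := (d * t - b) / (a - c * t).
have hs : c * x + d = (a * d - b * c) / (a - c * t) by rewrite /x; field.
have hx : c * x + d != 0 by rewrite hs mulf_neq0 ?invr_eq0.
have hM : moebius a b c d x = t.
  rewrite /moebius hs /x; field.
  by rewrite ht hdet.
have := horner_moebius_homog hp hx.
rewrite hom0 horner0 hM => /esym/eqP; rewrite mulf_eq0 expf_eq0 (negPf hx) andbF /=.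
by move=> /eqP ->; rewrite mul0r.
Qed.

End Homogenization.

(** * Derivatives and solutions on an open set *)

Section FieldDifferentiation.
Variable C : numFieldType.
Implicit Types (y : C -> C) (x : C).

Lemma is_derive1_horner (p : {poly C}) y x dy :
  is_derive x 1 y dy -> is_derive x 1 (fun z => p.[y z]) (p^`().[y x] * dy).
Proof.
move=> hy; elim/poly_ind: p => [|p k IH].
  under eq_fun do rewrite horner0.
  by rewrite deriv0 horner0 mul0r; exact: is_derive_cst.
under eq_fun do rewrite !hornerE.
apply: is_derive_eq.
by rewrite derivD derivM derivX derivC !hornerE /= /GRing.scale /=; ring.
Qed.

Lemma is_derive1V y x dy : y x != 0 -> is_derive x 1 y dy ->
  is_derive x 1 (fun z => (y z)^-1) (- (dy / y x ^+ 2)).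
Proof.
move=> yx0 hy; apply: DeriveDef; first exact: derivableV.
by rewrite deriveV // derive_val /GRing.scale /= mulNr mulrC.
Qed.

Lemma is_derive1_linear (k l x : C) : is_derive x 1 (fun z => k * z + l) k.
Proof.
apply: is_derive_eq.
by rewrite addr0 /GRing.scale /= mulr1.
Qed.

Lemma open_linear_neq0 (k l : C) : open [set x : C | k * x + l != 0].
Proof.
have -> : [set x : C | k * x + l != 0] = (fun z => k * z + l) @^-1` [set~ 0].
  by apply/seteqP; split => z /= /eqP.
apply: open_comp; last first.
  apply: closed_openC; apply: accessible_closed_set1.
  exact: hausdorff_accessible (@norm_hausdorff _ _).
move=> x _; apply: differentiable_continuous; apply/derivable1_diffP.
exact: (@ex_derive _ _ _ _ _ _ _ (is_derive1_linear k l x)).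
Qed.

(** The function [derive1 y] is known to equal [y1] only on D; as D is open, they agree near each of
    its points and so have the same derivative there. *)
Lemma solves_ode2_is_derive (D : set C) (F G H : {poly C}) y y1 y2 : open D ->
  (forall x, D x -> is_derive x 1 y (y1 x)) ->
  (forall x, D x -> is_derive x 1 y1 (y2 x)) ->
  (forall x, D x -> F.[x] * y2 x + G.[x] * y1 x + H.[x] * y x = 0) ->
  solves_ode2 D F G H y.
Proof.
move=> oD hy hy1 eqn x Dx.
have dyE z : D z -> derive1 y z = y1 z.
  by move=> Dz; rewrite derive1E; have := hy z Dz => ?; rewrite derive_val.
have near_y1 : \near x, y1 x = derive1 y x.
  by near=> z; rewrite dyE //; near: z; exact: open_nbhs_nbhs.
have hdy := near_eq_is_derive near_y1 (hy1 x Dx).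
split.
- exact: (@ex_derive _ _ _ _ _ _ _ (hy x Dx)).
- exact: (@ex_derive _ _ _ _ _ _ _ hdy).
- by rewrite [derive1 (derive1 y) x]derive1E derive_val dyE // eqn.
Unshelve. all: by end_near. Qed.

Lemma is_derive1_moebius (a b c d x : C) : c * x + d != 0 ->
  is_derive x 1 (moebius a b c d) ((a * d - b * c) / (c * x + d) ^+ 2).
Proof.
move=> hx.
have hu := is_derive1_linear a b x.
have hv := @is_derive1V (fun z => c * z + d) _ _ hx (is_derive1_linear c d x).
apply: is_derive_eq (is_deriveM hu hv) _.
by rewrite /GRing.scale /=; field.
Qed.

(** The derivative is written as s^k times a function again, so that the rule can be applied
    twice. *)
Lemma is_derive1_expMl (c d x : C) (k : nat) y dy : c * x + d != 0 ->
  is_derive x 1 y dy ->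
  is_derive x 1 (fun z => (c * z + d) ^+ k * y z)
    ((c * x + d) ^+ k * (dy + k%:R * c / (c * x + d) * y x)).
Proof.
move=> hx hy.
have hs := is_deriveX k (is_derive1_linear c d x).
have -> : (fun z => (c * z + d) ^+ k * y z) = (fun z => c * z + d) ^+ k * y.
  by apply/funext => z; rewrite !fctE.
apply: is_derive_eq (is_deriveM hs hy) _.
rewrite /GRing.scale /= !fctE.
(* The power rule has exponent [k.-1], truncated at k = 0, where the factor k kills the term. *)
case: k {hs} => [|k]; first by rewrite !expr0; ring.
by rewrite exprS /=; field.
Qed.

End FieldDifferentiation.

(* Both parts of the theorem are instances: k = 0 for R_n and k = n for Q_n. *)
Lemma moebius_ode (C : numFieldType) (a b c d : C) (f g p : {poly C}) (h : C)
    (k : nat) :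
  (size f <= 3)%N -> (size g <= 2)%N ->
  f * p^`()^`() + g * p^`() + h *: p = 0 ->
  let s := c *: 'X + d%:P in
  let f' := moebius_homog a b c d 2 f in
  let g' := moebius_homog a b c d 1 g in
  let D := a * d - b * c in
  D != 0 ->
  solves_ode2 [set x | c * x + d != 0]
    (s ^+ 2 * f')
    ((2 * (1 - k%:R) * c) *: (s * f') + D *: (s * g'))
    ((k%:R * (k%:R - 1) * c ^+ 2) *: f' - (k%:R * c * D) *: g' + (D ^+ 2 * h)%:P)
    (fun x => (c * x + d) ^+ k * p.[moebius a b c d x]).
Proof.
move=> hf hg ode s f' g' D D0.
pose M := moebius a b c d.
pose r x := p.[M x].
(* [r1] and [r2] are the first two derivatives of p o M, and [e] is the logarithmic derivative of
   s^k. *)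
pose r1 x := D * (p^`().[M x] * ((c * x + d) ^+ 2)^-1).
pose r2 x := p^`()^`().[M x] * (D / (c * x + d) ^+ 2) ^+ 2
             - 2 * c * D / (c * x + d) ^+ 3 * p^`().[M x].
pose e x := k%:R * c / (c * x + d).
have hr x : c * x + d != 0 -> is_derive x 1 r (r1 x).
  move=> hx; apply: is_derive_eq (is_derive1_horner p (is_derive1_moebius a b hx)) _.
  by rewrite /r1 /D /M; field.
have hr1 x : c * x + d != 0 -> is_derive x 1 r1 (r2 x).
  move=> hx.
  have h1 := is_derive1_horner p^`() (is_derive1_moebius a b hx).
  have s2 : (c * x + d) ^+ 2 != 0 by rewrite expf_neq0.
  have h2 := @is_derive1V _ ((fun z => c * z + d) ^+ 2) _ _ s2
    (is_deriveX 2 (is_derive1_linear c d x)).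
  have h3 := is_deriveZ D (is_deriveM h1 h2).
  apply: is_derive_eq h3 _.
  by rewrite !fctE /GRing.scale /= /r2 /D /M; field.
have he x : c * x + d != 0 -> is_derive x 1 e (- (k%:R * c ^+ 2 / (c * x + d) ^+ 2)).
  move=> hx.
  have h1 := is_deriveZ (k%:R * c)
    (@is_derive1V _ (fun z => c * z + d) _ _ hx (is_derive1_linear c d x)).
  by apply: is_derive_eq h1 _; rewrite /GRing.scale /=; field.
(* For y = s^k r: y' = s^k (r' + e r) and y'' = s^k (r'' + (e r)' + e (r' + e r)). *)
apply: (@solves_ode2_is_derive _ _ _ _ _ _
  (fun x => (c * x + d) ^+ k * (r1 x + e x * r x))
  (fun x => (c * x + d) ^+ k *
     (r2 x + (e x * r1 x - k%:R * c ^+ 2 / (c * x + d) ^+ 2 * r x)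
      + e x * (r1 x + e x * r x)))).
- exact: open_linear_neq0.
- by move=> x hx; exact: is_derive1_expMl (hr x hx).
- move=> x hx; apply: is_derive1_expMl => //.
  have h1 := is_deriveD (hr1 x hx) (is_deriveM (he x hx) (hr x hx)).
  by apply: is_derive_eq h1 _; rewrite /GRing.scale /=; ring.
- move=> x hx; rewrite /= in hx.
  have odeM : f.[M x] * p^`()^`().[M x] + g.[M x] * p^`().[M x] + h * p.[M x] = 0.
    by rewrite -!hornerM -hornerZ -!hornerD ode horner0.
  rewrite !(hornerD, hornerN, hornerM, hornerZ, hornerC, horner_exp, hornerX).
  rewrite !horner_moebius_homog // -/M /r1 /r2 /e /r.
  (* The new equation at x is the old one at M(x) multiplied by s^k D^2. *)
  transitivity ((c * x + d) ^+ k * D ^+ 2 *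
    (f.[M x] * p^`()^`().[M x] + g.[M x] * p^`().[M x] + h * p.[M x])).
    by field.
  by rewrite odeM mulr0.
Qed.

Theorem theorem8 (R : realType) (P : nat -> {poly R})
  (f g : {poly Cplx R}) (h : nat -> Cplx R) (a b c d : Cplx R)
  (hP : orthogonal_poly_seq P)
  (hf0 : f != 0) (hf : (size f <= 3)%N) (hg : (size g <= 2)%N)
  (hode : forall n, f * deriv (deriv (complex_poly (P n)))
                    + g * deriv (complex_poly (P n))
                    + h n *: complex_poly (P n) = 0)
  (hdet : a * d - b * c != 0) :
  let Rn (n : nat) (x : Cplx R) : Cplx R :=
    (complex_poly (P n)).[moebius a b c d x] in
  let Qn (n : nat) (x : Cplx R) : Cplx R :=
    (c * x + d) ^+ n * (complex_poly (P n)).[moebius a b c d x] in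
  let D : set (Cplx R) := [set x | c * x + d != 0] in
  (exists (F G : {poly Cplx R}) (H : nat -> Cplx R),
     [/\ F != 0, (size F <= 5)%N, (size G <= 4)%N &
         forall n, solves_ode2 D F G (H n)%:P (Rn n)])
  /\
  (exists (F : {poly Cplx R}) (G H : nat -> {poly Cplx R}),
     [/\ F != 0, (size F <= 5)%N,
         forall n, (size (G n) <= 4)%N /\ (size (H n) <= 3)%N &
         forall n, solves_ode2 D F (G n) (H n) (Qn n)]).
Proof.
move=> Rn Qn D.
pose s : {poly Cplx R} := c *: 'X + d%:P.
pose f' := moebius_homog a b c d 2 f.
pose g' := moebius_homog a b c d 1 g.
have sz_s : (size s <= 2)%N by exact: size_linear.
have sz_f : (size f' <= 3)%N by exact: size_moebius_homog.
have sz_g : (size g' <= 2)%N by exact: size_moebius_homog.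
have s0 : s != 0.
  apply: contra_neq hdet => /linear_poly_eq0 [-> ->].
  by rewrite !mulr0 subrr.
have sz_F : (size (s ^+ 2 * f')%R <= 5)%N.
  by apply: (@leq_size_polyM _ _ _ 2 2) sz_f; exact: (@leq_size_polyM _ s s 1 1).
have F0 : s ^+ 2 * f' != 0.
  by rewrite mulf_neq0 ?expf_neq0 //; exact: moebius_homog_neq0.
have sz_G k l : (size (k *: (s * f') + l *: (s * g'))%R <= 4)%N.
  apply: leq_size_polyD; apply: leq_size_polyZ.
    exact: (@leq_size_polyM _ _ _ 1 2).
  exact: leqW (@leq_size_polyM _ _ _ 1 1 sz_s sz_g).
have ode n k := moebius_ode k hf hg (hode n) hdet.
split.
  exists (s ^+ 2 * f'), ((2 * c) *: (s * f') + (a * d - b * c) *: (s * g')),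
    (fun n => (a * d - b * c) ^+ 2 * h n).
  split=> // n; have := ode n 0%N.
  have -> : (fun x => (c * x + d) ^+ 0 * (complex_poly (P n)).[moebius a b c d x])
            = Rn n.
    by apply/funext => x; rewrite expr0 mul1r.
  (* At k = 0 the terms in [f'] and [g'] drop out of the last coefficient, leaving the constant D^2
     h_n. *)
  by rewrite subr0 mulr1 !mul0r !scale0r subrr add0r.
exists (s ^+ 2 * f'),
  (fun n => (2 * (1 - n%:R) * c) *: (s * f') + (a * d - b * c) *: (s * g')),
  (fun n => (n%:R * (n%:R - 1) * c ^+ 2) *: f'
            - (n%:R * c * (a * d - b * c)) *: g'
            + ((a * d - b * c) ^+ 2 * h n)%:P).
split=> // n; split; first exact: sz_G.
apply: leq_size_polyD; last exact: leq_trans (size_polyC_leq1 _) _.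
apply: leq_size_polyD; first exact: leq_size_polyZ.
by rewrite size_polyN; apply: leq_size_polyZ; exact: leqW.
Qed.
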